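(* For $n\ge1$, the $^*$-algebras $\mathsf C$ and $\bigwedge(\mathsf C^n)$ over $\mathsf C$ are not formally Morita equivalent.
   Context: $\mathsf R$ is an ordered ring (commutative ring with $1\ne0$ and a subset $\mathsf P$ closed under sums and products such that $\mathsf R$ is the disjoint union $-\mathsf P\cup\{0\}\cup\mathsf P$), and $\mathsf C=\mathsf R(\mathrm i)=\mathsf R\oplus\mathrm i\mathsf R$, $\mathrm i^2=-1$, with the usual conjugation (which makes $\mathsf C$ a $^*$-algebra over itself). $\bigwedge(\mathsf C^n)$ is the Grassmann (exterior) algebra of $\mathsf C^n$ with canonical basis $e_1,\dots,e_n$, made into a $^*$-algebra by the antilinear involutive anti-automorphism with $\mathsf 1^*=\mathsf 1$ and $e_i^*=e_i$. A $^*$-algebra over $\mathsf C$ is an associative $\mathsf C$-algebra with an antilinear involution satisfying $(AB)^*=B^*A^*$. A linear $\omega:\mathcal A\to\mathsf C$ is positive if $\omega(A^*A)\ge0$ for all $A$; a Hermitian $A$ is positive ($A\ge0$) if $\omega(A)\ge0$ for all positive linear functionals $\omega$. A pre-Hilbert space over $\mathsf C$ is a $\mathsf C$-module with a Hermitian inner product (linear in the second argument), $\langle\phi,\phi\rangle\ge0$, and $\langle\phi,\phi\rangle=0\Rightarrow\phi=0$. A $^*$-representation is a $^*$-homomorphism into the adjointable endomorphisms of a pre-Hilbert space. A $(\mathcal B$-$\mathcal A)$-equivalence bimodule is a $\mathsf C$-module $\mathfrak X$ with commuting left $\mathcal B$- and right $\mathcal A$-actions and maps $\langle\cdot,\cdot\rangle_{\mathcal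 A}:\mathfrak X\times\mathfrak X\to\mathcal A$, ${}_{\mathcal B}\langle\cdot,\cdot\rangle:\mathfrak X\times\mathfrak X\to\mathcal B$ such that: E1) X1) $\langle\cdot,\cdot\rangle_{\mathcal A}$ is $\mathsf C$-linear in the second argument; X2) $\langle x,y\rangle_{\mathcal A}=\langle y,x\rangle_{\mathcal A}^*$; X3) $\langle x,y\cdot A\rangle_{\mathcal A}=\langle x,y\rangle_{\mathcal A}A$; X4) $\langle x,x\rangle_{\mathcal A}\ge0$; X5) $\langle x,B\cdot y\rangle_{\mathcal A}=\langle B^*\cdot x,y\rangle_{\mathcal A}$; X6) the $\mathsf C$-span of all $\langle x,y\rangle_{\mathcal A}$ is $\mathcal A$. E2) Y1) ${}_{\mathcal B}\langle\cdot,\cdot\rangle$ is $\mathsf C$-linear in the first argument; Y2) ${}_{\mathcal B}\langle x,y\rangle={}_{\mathcal B}\langle y,x\rangle^*$; Y3) ${}_{\mathcal B}\langle B\cdot x,y\rangle=B\,{}_{\mathcal B}\langle x,y\rangle$; Y4) ${}_{\mathcal B}\langle x,x\rangle\ge0$; Y5) ${}_{\mathcal B}\langle x\cdot A,y\rangle={}_{\mathcal B}\langle x,y\cdot A^*\rangle$; Y6) the $\mathsf C$-span of all ${}_{\mathcal B}\langle x,y\rangle$ is $\mathcal B$. E3) ${}_{\mathcal B}\langle x,y\rangle\cdot z=x\cdot\langle y,z\rangle_{\mathcal A}$. E4) P): for every $^*$-representation $(\mathfrak H,\pi)$ of $\mathcal A$ the form $\langle x\otimes\psi,y\otimes\phi\rangle=\langle\psi,\pi(\langle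 x,y\rangle_{\mathcal A})\phi\rangle$ on $\mathfrak X\otimes_{\mathcal A}\mathfrak H$ is positive semi-definite; and Q): P holds for the conjugate $(\mathcal A$-$\mathcal B)$-bimodule $\overline{\mathfrak X}$ (conjugate $\mathsf C$-module, $A\bar x=\overline{xA^*}$, $\bar xB=\overline{B^*x}$) with $\langle\bar x,\bar y\rangle_{\mathcal B}={}_{\mathcal B}\langle x,y\rangle$. $\mathcal A$ and $\mathcal B$ are formally Morita equivalent if a $(\mathcal B$-$\mathcal A)$-equivalence bimodule exists (a symmetric relation). *)

(* Defs.v *)
From HB Require Import structures.
From mathcomp Require Import all_boot all_order all_algebra.
From mathcomp Require Import complex.

Set Implicit Arguments.
Unset Strict Implicit.
Unset Printing Implicit Defensive.

Import Order.TTheory GRing.Theory Num.Theory.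
Local Open Scope ring_scope.

(* An ordered ring is a [realDomainType]: trichotomy makes it an integral     *)
(* domain, and its norm and its set of units are determined by the order and  *)
(* the ring structure.                                                        *)

(* The library makes [R[i]] a ring only when [R] is a field; the alias [Cx R] *)
(* carries the same operations over an arbitrary ordered ring.                *)
Definition Cx (R : realDomainType) : Type := R[i].

Section Cx.
Variable R : realDomainType.

HB.instance Definition _ := GRing.Zmodule.copy (Cx R) R[i].

Definition cx1 : Cx R := Complex 1 0.
Definition cxM (x y : Cx R) : Cx R := ComplexField.mulc x y.

Fact cx_mul1 : left_id cx1 cxM.
Proof. by case=> a b; rewrite /cxM /= !mul1r !mul0r subr0 addr0. Qed.

Fact cx_mulDl : left_distributive cxM +%R.
Proof.
case=> [a b] [c d] [e f]; apply/eqP; rewrite eq_complex /= !mulrDl opprD.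
by rewrite (addrACA (a * e)) (addrACA (a * f)) !eqxx.
Qed.

Fact cx1_neq0 : cx1 != 0.
Proof. by rewrite eq_complex /= oner_eq0. Qed.

HB.instance Definition _ := GRing.Zmodule_isComNzRing.Build (Cx R)
  (@ComplexField.mulcA R) (@ComplexField.mulcC R) cx_mul1 cx_mulDl cx1_neq0.

Definition cxconj (x : Cx R) : Cx R := conjc x.

Lemma cxconjK : involutive cxconj.
Proof. by case=> a b; rewrite /cxconj /= opprK. Qed.

Lemma cxconjD : {morph cxconj : x y / x + y}.
Proof. by case=> [a b] [c d]; congr Complex; rewrite opprD. Qed.

Lemma cxconjM : {morph cxconj : x y / x * y}.
Proof.
case=> [a b] [c d]; congr Complex; first by rewrite mulrNN.
by rewrite opprD mulrN mulNr.
Qed.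

Definition cx_ge0 (x : Cx R) : bool := (complex.Im x == 0) && (0 <= complex.Re x).

End Cx.

HB.mixin Record Algebra_isStar (R : realDomainType) A of GRing.Algebra (Cx R) A := {
  star : A -> A;
  starK : involutive star;
  starD : {morph star : a b / a + b};
  starZ : forall (c : Cx R) (a : A), star (c *: a) = cxconj c *: star a;
  starM : forall a b : A, star (a * b) = star b * star a
}.

#[short(type="starAlgType")]
HB.structure Definition StarAlgebra (R : realDomainType) :=
  {A of Algebra_isStar R A & GRing.Algebra (Cx R) A}.

HB.instance Definition _ (R : realDomainType) :=
  Algebra_isStar.Build R (Cx R)^o
    (@cxconjK R) (@cxconjD R) (@cxconjM R)
    (fun a b => etrans (cxconjM a b) (mulrC _ _)).

Section Positivity.
Variables (R : realDomainType) (A : starAlgType R).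

Definition positive_functional (omega : {scalar A}) : Prop :=
  forall a : A, cx_ge0 (omega (star a * a)).

Definition positive_element (a : A) : Prop :=
  star a = a /\
  forall omega : {scalar A}, positive_functional omega -> cx_ge0 (omega a).

End Positivity.

HB.mixin Record Lmodule_isPreHilbert (R : realDomainType) H
    of GRing.Lmodule (Cx R) H := {
  hdot : H -> H -> Cx R;
  hdot_linear : forall phi, scalar (hdot phi);
  hdot_herm : forall phi psi, hdot phi psi = cxconj (hdot psi phi);
  hdot_ge0 : forall phi, cx_ge0 (hdot phi phi);
  hdot_eq0 : forall phi, hdot phi phi = 0 -> phi = 0
}.

#[short(type="preHilbertType")]
HB.structure Definition PreHilbert (R : realDomainType) :=
  {H of Lmodule_isPreHilbert R H & GRing.Lmodule (Cx R) H}.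

(* [rep_star] says that [rep (star a)] is the adjoint of [rep a]. As for the  *)
(* module actions below, the unit is not required to act as the identity.     *)
Record star_rep (R : realDomainType) (A : starAlgType R) (H : preHilbertType R) :=
  StarRep {
    rep :> A -> H -> H;
    rep_linear : forall a, linear (rep a);
    rep_lin : forall (c : Cx R) a b psi,
      rep (c *: a + b) psi = c *: rep a psi + rep b psi;
    repM : forall a b psi, rep (a * b) psi = rep a (rep b psi);
    rep_star : forall a phi psi,
      hdot phi (rep a psi) = hdot (rep (star a) phi) psi
  }.

(* A sequence [s] of pairs [(x, psi)] stands for the sum of the elementary    *)
(* tensors of [x] and [psi] in the tensor product of [X] and [H] over [A];    *)
(* every element of that product is of this form.                             *)
Definition tensor_form (R : realDomainType) (A : starAlgType R) (X : Type)
    (ip : X -> X -> A) (H : preHilbertType R) (pi : star_rep A H)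
    (s t : seq (X * H)) : Cx R :=
  \sum_(u <- s) \sum_(v <- t) hdot u.2 (pi (ip u.1 v.1) v.2).

Definition tensor_positive (R : realDomainType) (A : starAlgType R) (X : Type)
    (ip : X -> X -> A) : Prop :=
  forall (H : preHilbertType R) (pi : star_rep A H) (s : seq (X * H)),
    cx_ge0 (tensor_form ip pi s s).

Definition full_form (R : realDomainType) (A : starAlgType R) (X : Type)
    (ip : X -> X -> A) : Prop :=
  forall a : A, exists s : seq (Cx R * (X * X)),
    a = \sum_(u <- s) u.1 *: ip u.2.1 u.2.2.

Record equivalence_bimodule (R : realDomainType) (B A : starAlgType R) :=
  EquivalenceBimodule {
    bimod :> lmodType (Cx R);
    lact : B -> bimod -> bimod;
    ract : bimod -> A -> bimod;
    rip : bimod -> bimod -> A;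
    lip : bimod -> bimod -> B;

    lact_linear : forall b, linear (lact b);
    lact_lin : forall (c : Cx R) b b' x,
      lact (c *: b + b') x = c *: lact b x + lact b' x;
    lactM : forall b b' x, lact (b * b') x = lact b (lact b' x);
    ract_linear : forall a, linear (ract^~ a);
    ract_lin : forall (c : Cx R) a a' x,
      ract x (c *: a + a') = c *: ract x a + ract x a';
    ractM : forall a a' x, ract x (a * a') = ract (ract x a) a';
    lract : forall b x a, ract (lact b x) a = lact b (ract x a);

    rip_linear : forall x, linear (rip x);
    rip_star : forall x y, rip x y = star (rip y x);
    rip_ract : forall x y a, rip x (ract y a) = rip x y * a;
    rip_ge0 : forall x, positive_element (rip x x);
    rip_lact : forall x y b, rip x (lact b y) = rip (lact (star b) x) y;
    rip_full : full_form rip;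

    lip_linear : forall y, linear (lip^~ y);
    lip_star : forall x y, lip x y = star (lip y x);
    lip_lact : forall x y b, lip (lact b x) y = b * lip x y;
    lip_ge0 : forall x, positive_element (lip x x);
    lip_ract : forall x y a, lip (ract x a) y = lip x (ract y (star a));
    lip_full : full_form lip;

    lip_rip : forall x y z, lact (lip x y) z = ract x (rip y z);

    rip_tensor_positive : tensor_positive rip;
    (* The previous condition for the conjugate bimodule, which has the same  *)
    (* elements as [bimod] and the [B]-valued inner product [lip].            *)
    lip_tensor_positive : tensor_positive lip
  }.

Definition formally_Morita_equivalent (R : realDomainType) (A B : starAlgType R)
    : Prop :=
  inhabited (equivalence_bimodule B A).

(* [f : grassmann R n] is \sum_S f(S) e_S, where e_S is the product of the    *)
(* e_i, i in S, in increasing order of i. For disjoint T and U, e_T e_U is    *)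
(* e_(T :|: U) up to the sign (-1) ^+ ninv T U.                               *)
Definition grassmann (R : realDomainType) (n : nat) : Type :=
  {ffun {set 'I_n} -> (Cx R)^o}.

Section Grassmann.
Variables (R : realDomainType) (n : nat).
Local Notation G := (grassmann R n).
Local Notation C := (Cx R).
Implicit Types (S T U V : {set 'I_n}) (f g h : G) (i j : 'I_n).

HB.instance Definition _ := GRing.Lmodule.copy G {ffun {set 'I_n} -> (Cx R)^o}.

Definition ninv T U : nat := \sum_(i in T) \sum_(j in U) (j < i)%N.

Definition blade S : G := [ffun T => (T == S)%:R].
Definition gen i : G := blade [set i].

Definition gmul f g : G := [ffun S : {set 'I_n} =>
  \sum_(T : {set 'I_n} | T \subset S)
    (-1) ^+ ninv T (S :\: T) * f T * g (S :\: T)].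

(* Reversing the factors of e_S is a product of 'C(#|S|, 2) transpositions.   *)
Definition gstar f : G := [ffun S : {set 'I_n} =>
  (-1) ^+ 'C(#|S|, 2) * cxconj (f S)].

Fact ninvDl T U V : T \subset U -> ninv U V = (ninv T V + ninv (U :\: T) V)%N.
Proof. by move=> sTU; rewrite /ninv (big_setID T) /= (setIidPr sTU). Qed.

Fact ninvDr T U V : T \subset U -> ninv V U = (ninv V T + ninv V (U :\: T))%N.
Proof.
move=> sTU; rewrite /ninv -big_split /=; apply: eq_bigr => i _.
by rewrite (big_setID T) /= (setIidPr sTU).
Qed.

Fact ninvC T U : [disjoint T & U] -> (ninv T U + ninv U T)%N = (#|T| * #|U|)%N.
Proof.
move=> dTU; rewrite /ninv [X in (_ + X)%N]exchange_big -big_split /=.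
rewrite -sum_nat_const; apply: eq_bigr => i iT; rewrite -big_split -sum1_card.
apply: eq_bigr => j jU /=; case: ltngtP => // /val_inj eij.
by rewrite -eij (disjointFl dTU) in iT.
Qed.

Fact gmulA : associative gmul.
Proof.
move=> f g h; apply/ffunP=> S; rewrite !ffunE.
transitivity (\sum_(T : {set 'I_n} | T \subset S)
  \sum_(U : {set 'I_n} | U \subset S :\: T)
   (-1) ^+ (ninv U (S :\: T :\: U) + ninv T (S :\: T))
     * (f T * (g U * h (S :\: T :\: U)))).
  apply: eq_bigr => T sTS; rewrite ffunE mulr_sumr; apply: eq_bigr => U sU.
  by rewrite addnC exprD -!mulrA; congr (_ * _); rewrite mulrCA.
transitivity (\sum_(T : {set 'I_n} | T \subset S)
  \sum_(W : {set 'I_n} | (T \subset W) && (W \subset S))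
   (-1) ^+ (ninv W (S :\: W) + ninv T (W :\: T))
     * (f T * (g (W :\: T) * h (S :\: W)))).
  apply: eq_bigr => T sTS.
  rewrite [RHS](reindex_onto (fun U => T :|: U) (fun W => W :\: T)) /=; last first.
    by move=> W /andP[sTW _]; rewrite -[RHS](setID W T) (setIidPr sTW).
  have dE U : (T :|: U) :\: T = U :\: T by rewrite setDUl setDv set0U.
  apply: eq_big => [U|U].
    rewrite dE subsetUl subUset sTS subsetD /=; congr (_ && _).
    by rewrite -setI_eq0 (sameP eqP setDidPl) -setI_eq0.
  rewrite subsetD => /andP[sUS dUT].
  have eU : U :\: T = U by apply/setDidPl.
  have sU : U \subset S :\: T by rewrite subsetD sUS.
  rewrite dE eU -setDDl (ninvDr _ sU) (ninvDl _ (subsetUl T U)) dE eU.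
  by congr (_ ^+ _ * _); rewrite addnCA addnC (addnC (ninv U _)).
rewrite (exchange_big_dep (fun W : {set 'I_n} => W \subset S)) /=; last first.
  by move=> T W _ /andP[].
apply: eq_bigr => W sWS; rewrite ffunE mulr_sumr mulr_suml.
apply: eq_big => [T|T /and3P[_ sTW _]].
  by rewrite sWS andbT; apply: andb_idl => /subset_trans; apply.
by rewrite exprD !mulrA.
Qed.

Fact gmul1l : left_id (blade set0) gmul.
Proof.
move=> f; apply/ffunP=> S; rewrite ffunE (bigD1 set0) ?sub0set //=.
rewrite ffunE eqxx setD0 /ninv big_set0 !mul1r big1 ?addr0 // => T /andP[_ T0].
by rewrite ffunE (negPf T0) mulr0 mul0r.
Qed.

Fact gmul1r : right_id (blade set0) gmul.
Proof.
move=> f; apply/ffunP=> S; rewrite ffunE (bigD1 S) //= ffunE setDv eqxx mulr1.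
rewrite /ninv [X in (-1) ^+ X]big1 => [|i _]; last by rewrite big_set0.
rewrite mul1r big1 ?addr0 // => T /andP[sTS nTS].
rewrite ffunE setD_eq0 (_ : (S \subset T) = false) ?mulr0 //.
by apply: contraNF nTS => sST; rewrite eqEsubset sTS.
Qed.

Fact gmulDl : left_distributive gmul +%R.
Proof.
move=> f g h; apply/ffunP=> S; rewrite !ffunE -big_split /=.
by apply: eq_bigr => T _; rewrite ffunE mulrDr mulrDl.
Qed.

Fact gmulDr : right_distributive gmul +%R.
Proof.
move=> f g h; apply/ffunP=> S; rewrite !ffunE -big_split /=.
by apply: eq_bigr => T _; rewrite ffunE mulrDr.
Qed.

Fact gone_neq0 : blade set0 != 0.
Proof. by apply/eqP=> /ffunP/(_ set0)/eqP; rewrite !ffunE eqxx oner_eq0. Qed.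

HB.instance Definition _ := GRing.Zmodule_isNzRing.Build G
  gmulA gmul1l gmul1r gmulDl gmulDr gone_neq0.

Fact gscaleAl (c : C) f g : c *: (f * g) = c *: f * g.
Proof.
apply/ffunP=> S; rewrite !ffunE /GRing.scale /= mulr_sumr.
by apply: eq_bigr => T _; rewrite ffunE !mulrA [c * _]mulrC.
Qed.

HB.instance Definition _ := GRing.Lmodule_isLalgebra.Build C G gscaleAl.

Fact gscaleAr (c : C) f g : c *: (f * g) = f * (c *: g).
Proof.
apply/ffunP=> S; rewrite !ffunE /GRing.scale /= mulr_sumr.
by apply: eq_bigr => T _; rewrite ffunE; apply: mulrCA.
Qed.

HB.instance Definition _ := GRing.Lalgebra_isAlgebra.Build C G gscaleAr.

Fact cxconj0 : cxconj (0 : C) = 0.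
Proof. by congr Complex; rewrite oppr0. Qed.

Fact cxconj_sign k : cxconj ((-1) ^+ k : C) = (-1) ^+ k.
Proof.
elim: k => [|k IHk]; first by congr Complex; rewrite oppr0.
by rewrite exprS cxconjM IHk; congr (_ * _); congr Complex; rewrite !oppr0.
Qed.

Fact gstarK : involutive gstar.
Proof.
move=> f; apply/ffunP=> S.
by rewrite !ffunE cxconjM cxconj_sign cxconjK mulrA -expr2 sqrr_sign mul1r.
Qed.

Fact gstarD : {morph gstar : f g / f + g}.
Proof. by move=> f g; apply/ffunP=> S; rewrite !ffunE cxconjD mulrDr. Qed.

Fact gstarZ (c : C) f : gstar (c *: f) = cxconj c *: gstar f.
Proof.
by apply/ffunP=> S; rewrite !ffunE /GRing.scale /= cxconjM mulrCA.
Qed.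

Fact bin2D a b : 'C(a + b, 2) = ('C(a, 2) + 'C(b, 2) + a * b)%N.
Proof.
elim: a => [|a IHa]; first by rewrite add0n addn0.
by rewrite addSn !binS !bin1 IHa mulSn addnACA (addnAC _ 'C(b, 2)) (addnC b).
Qed.

Fact gstarM f g : gstar (f * g) = gstar g * gstar f.
Proof.
apply/ffunP=> S; rewrite !ffunE.
rewrite [in RHS](reindex_onto (fun T => S :\: T) (fun T => S :\: T)) /=; last first.
  by move=> T sTS; rewrite setDDr setDv set0U (setIidPr sTS).
rewrite (big_morph _ (@cxconjD R) cxconj0) mulr_sumr.
apply: eq_big => [T|T sTS].
  by rewrite subsetDl setDDr setDv set0U (sameP eqP setIidPr).
have eT : S :\: (S :\: T) = T by rewrite setDDr setDv set0U (setIidPr sTS).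
rewrite eT !ffunE !cxconjM cxconj_sign.
have dT : [disjoint T & S :\: T] by rewrite -setI_eq0 setIDA setIC -setIDA setDv setI0.
set U := S :\: T in dT *.
have key : (-1) ^+ 'C(#|S|, 2) * (-1) ^+ ninv T U
    = (-1) ^+ ninv U T * (-1) ^+ 'C(#|U|, 2) * (-1) ^+ 'C(#|T|, 2) :> C.
  rewrite -(cardsID T S) (setIidPr sTS) bin2D -(ninvC dT) !exprD -!mulrA.
  rewrite [X in _ * (_ * X)]mulrA mulrAC -expr2 sqrr_sign mul1r.
  by rewrite mulrA mulrC [_ * (-1) ^+ 'C(#|U|, 2)]mulrC.
rewrite 2!mulrA key -mulrA (mulrC (cxconj (f T))) mulrACA.
by rewrite -(mulrA _ _ (cxconj (g U))).
Qed.

HB.instance Definition _ := Algebra_isStar.Build R G gstarK gstarD gstarZ gstarM.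

Fact bladeM T U :
  blade T * blade U = if [disjoint T & U] then (-1) ^+ ninv T U *: blade (T :|: U) else 0.
Proof.
apply/ffunP=> S; rewrite ffunE.
have dE : T \subset S -> (S :\: T == U) = [disjoint T & U] && (S == T :|: U).
  move=> sTS; apply/eqP/andP=> [<-|[dTU /eqP->]].
    split; first by rewrite -setI_eq0 setIDA setIC -setIDA setDv setI0.
    by rewrite setDE setUIr setUCr setIT (setUidPr sTS).
  by rewrite setDUl setDv set0U; apply/setDidPl; rewrite disjoint_sym.
have [sTS|nTS] := boolP (T \subset S); last first.
  rewrite big1 => [|V sVS]; last first.
    rewrite ffunE; case: eqP => [eVT|_]; first by rewrite -eVT sVS in nTS.
    by rewrite mulr0 mul0r.
  case: ifP => _; rewrite !ffunE //; case: eqP => [eS|_].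
    by rewrite eS subsetUl in nTS.
  by rewrite /GRing.scale /= mulr0.
rewrite (bigD1 T) //= big1 => [|V /andP[_ /negPf nVT]]; last first.
  by rewrite ffunE nVT mulr0 mul0r.
rewrite addr0 !ffunE eqxx mulr1 dE //.
case dTU: [disjoint T & U]; rewrite !ffunE /= ?mulr0 //.
rewrite /GRing.scale /=; case: eqP => [->|_]; last by rewrite !mulr0.
by rewrite setDUl setDv set0U (setDidPl _) // disjoint_sym dTU.
Qed.

Lemma gen_sqr i : gen i * gen i = 0.
Proof. by rewrite bladeM -setI_eq0 setIid -cards_eq0 cards1. Qed.

Lemma gen_anticomm i j : gen i * gen j = - (gen j * gen i).
Proof.
have [->|nij] := eqVneq i j; first by rewrite gen_sqr oppr0.
wlog lt_ij : i j nij / (i < j)%N => [IH|].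
  have [lt_ij|lt_ji|eij] := ltngtP i j; first exact: IH.
  - by rewrite (IH j i) ?opprK // eq_sym.
  - by rewrite (val_inj eij) eqxx in nij.
have dij (k l : 'I_n) : k != l -> [disjoint [set k] & [set l]].
  by move=> nkl; rewrite disjoints1 inE.
have nji : j != i by rewrite eq_sym.
rewrite !bladeM !dij // /ninv !big_set1 lt_ij ltnNge ltnW //=.
by rewrite expr0 expr1 scale1r scaleN1r opprK setUC.
Qed.

Lemma blade_prod S : blade S = \prod_(i <- enum S) gen i.
Proof.
have sS : sorted ltn (map val (enum S)).
  apply: (subseq_sorted ltn_trans (s2 := map val (enum 'I_n))).
    by apply: map_subseq; rewrite [X in subseq _ X]enumT; apply: filter_subseq.
  by rewrite val_enum_ord iota_ltn_sorted.
rewrite -{1}[S]set_enum; elim: (enum S) sS => [_|i s IHs].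
  by rewrite big_nil; congr blade; apply/setP=> i; rewrite !inE.
rewrite /= big_cons => s_gt_i; rewrite -IHs ?(path_sorted s_gt_i) //.
have {s_gt_i} s_gt_i : {in s, forall j, i < j}%N.
  by apply/allP; move/(order_path_min ltn_trans): s_gt_i; rewrite all_map.
rewrite bladeM disjoints1 inE ifT; last by apply/negP=> /s_gt_i; rewrite ltnn.
rewrite /ninv big_set1 big1 ?scale1r => [|j]; last first.
  by rewrite inE => /s_gt_i lt_ij; rewrite ltnNge ltnW.
by congr blade; apply/setP=> j; rewrite !inE.
Qed.

Lemma grassmann_basis f : f = \sum_S f S *: blade S.
Proof.
apply/ffunP=> T; rewrite sum_ffunE (bigD1 T) //= big1 => [|S nST].
  by rewrite !ffunE eqxx addr0 /GRing.scale /= mulr1.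
by rewrite !ffunE eq_sym (negPf nST) /GRing.scale /= mulr0.
Qed.

Lemma star_gen i : star (gen i) = gen i.
Proof.
apply/ffunP=> S; rewrite ffunE /= ffunE; case: eqP => [->|_].
  by rewrite cards1 mul1r; apply: (cxconj_sign 0).
by rewrite cxconj0 mulr0.
Qed.

End Grassmann.

(* Main.v *)
Require Import Defs.
From mathcomp Require Import all_boot all_order all_algebra.
From mathcomp Require Import complex ring.

Import Order.TTheory GRing.Theory Num.Theory.
Local Open Scope ring_scope.

(* Let e be a generator of the Grassmann algebra: it is Hermitian and e e = 0, *)
(* so e x is isotropic for the C-valued inner product, for every x. By         *)
(* Cauchy-Schwarz e x is orthogonal to every y, that is, <x, e y> = 0; by E3)  *)
(* and Y6) every b in B then satisfies b e y = 0, so e acts by 0. Hence e      *)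
(* annihilates all B-valued inner products, and e = 0 by Y6) again.            *)

Lemma linear_at0 (S : pzRingType) (U V : lmodType S) (f : U -> V) :
  linear f -> f 0 = 0.
Proof. by move=> /(_ (- 1) 0 0); rewrite !scaleN1r oppr0 addr0 addNr. Qed.

(* Cauchy-Schwarz for h u u = 0, without division: with q = h u y and          *)
(* p = h y y, positivity at - (p + 1) q u + |q|^2 y reads - (p + 2) |q|^4 >= 0. *)
Lemma isotropic_orthogonal (R : realDomainType) (X : lmodType (Cx R))
    (h : X -> X -> (Cx R)^o) (h_lin : forall x, linear (h x))
    (h_herm : forall x y, h x y = cxconj (h y x))
    (h_ge0 : forall x, cx_ge0 (h x x)) (u y : X) :
  h u u = 0 -> h u y = 0.
Proof.
have hD x a v b w : h x (a *: v + b *: w) = a * h x v + b * h x w.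
  rewrite h_lin; congr (_ + _); rewrite -[b *: w]addr0 h_lin.
  by rewrite (linear_at0 _ _ _ _ (h_lin x)) addr0.
move=> huu; have := h_ge0 y.
case eyy: (h y y) => [p p'] /andP[/eqP/= p'0 p_ge0].
case euy: (h u y) => [q1 q2].
have eyu : h y u = Complex q1 (- q2) by rewrite h_herm euy.
(* The value is [(p - 2 * t) * s ^+ 2]; the extra 1 in [t] makes its coefficient negative even at
   [p = 0]. *)
set s := q1 ^+ 2 + q2 ^+ 2; pose t := p + 1.
pose a : Cx R := Complex (- (t * q1)) (- (t * q2)); pose b : Cx R := Complex s 0.
have := h_ge0 (a *: u + b *: y).
rewrite hD (h_herm _ u) (h_herm _ y) !hD huu euy eyu eyy p'0 mulr0 add0r.
rewrite /cx_ge0 /= => /andP[_].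
set e := (X in 0 <= X).
have -> : e = - ((p + 2) * s ^+ 2) by rewrite /e /t /s; ring.
rewrite oppr_ge0 pmulr_rle0; last by rewrite ltr_wpDl.
move=> s2_le0; have : s == 0 by rewrite -sqrf_eq0 eq_le s2_le0 sqr_ge0.
by rewrite paddr_eq0 ?sqr_ge0 // !sqrf_eq0 => /andP[/eqP-> /eqP->].
Qed.

(** The identity functional is positive, as [cxconj z * z] is a sum of two squares. *)
Lemma positive_element_cx (R : realDomainType) (c : (Cx R)^o) :
  positive_element c -> cx_ge0 c.
Proof.
case=> _ /(_ idfun); apply=> -[a b]; rewrite /cx_ge0 /=; apply/andP; split.
  by apply/eqP; ring.
by rewrite mulNr opprK addr_ge0 // -expr2 sqr_ge0.
Qed.

Lemma hermitian_square_zero (R : realDomainType) (B : starAlgType R)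
    (X : equivalence_bimodule B (Cx R)^o) (e : B) :
  star e = e -> e * e = 0 -> e = 0.
Proof.
move=> e_star ee0.
have lact0l (x : X) : lact 0 x = 0.
  exact: (linear_at0 _ _ _ (fun b => lact b x)
            (fun c b b' => lact_lin c b b' x)).
have rip0 (x : X) : rip x 0 = 0 := linear_at0 _ _ _ _ (rip_linear x).
have rip_e (x y : X) : rip x (lact e y) = 0.
  rewrite rip_lact e_star; apply: isotropic_orthogonal.
  - exact: rip_linear.
  - exact: rip_star.
  - by move=> z; apply/positive_element_cx/rip_ge0.
  - by rewrite rip_lact e_star -lactM ee0 lact0l rip_star rip0; apply: cxconj0.
have e_act (y : X) : lact e y = 0.
  (* The action need not be unital, but [e = 1 * e], and [1] is a combination of values of [lip]. *)
  rewrite -[e]mul1r lactM; have [s ->] := lip_full X 1.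
  elim: s => [|[c [x z]] s IHs]; first by rewrite big_nil lact0l.
  rewrite big_cons lact_lin IHs addr0 lip_rip rip_e.
  by rewrite (linear_at0 _ _ _ (ract x)) ?scaler0 // => k a a'; apply: ract_lin.
(* Now [e * lip x z = lip (lact e x) z = 0]. *)
rewrite -[e]mulr1; have [s ->] := lip_full X 1.
rewrite mulr_sumr big1 // => -[c [x z]] _ /=.
rewrite -scalerAr -lip_lact e_act.
by rewrite (linear_at0 _ _ _ (fun y : X => lip y z) (lip_linear z)) scaler0.
Qed.

Theorem corollary5p20 (R : realDomainType) (n : nat) (n_ge1 : (1 <= n)%N) :
  ~ formally_Morita_equivalent (Cx R)^o (grassmann R n).
Proof.
case=> X; pose i := Ordinal n_ge1.
have /ffunP/(_ [set i])/eqP : gen R i = 0.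
  exact: hermitian_square_zero X _ (star_gen R i) (gen_sqr R i).
by rewrite !ffunE eqxx oner_eq0.
Qed.
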